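(* Let $P_n(x)$ denote the $n$-th Legendre polynomial. Then for every integer $n\geq 1$ and every real $x\in[-1,1]$, $$|x|\,P_n(x)^2-P_{n-1}(x)P_{n+1}(x)\geq 0,$$ and, for such $n$ and $x$, equality holds if and only if either $x=0$ and $n$ is even, or $|x|=1$.
   Context: The Legendre polynomials $P_n(x)$, $n\geq 0$, are the real polynomials determined by $P_0(x)=1$, $P_1(x)=x$ and the three-term recurrence $(n+2)P_{n+2}(x)=(2n+3)\,x\,P_{n+1}(x)-(n+1)P_n(x)$ for $n\geq 0$ (standard normalization, $P_n(1)=1$). *)

(* Defs.v *)
From mathcomp Require Import all_boot all_order all_algebra.
From mathcomp Require Import reals.

Set Implicit Arguments.
Unset Strict Implicit.
Unset Printing Implicit Defensive.

Import Order.TTheory GRing.Theory Num.Theory.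
Local Open Scope ring_scope.

(* The three-term recurrence solved for the highest index, hence the division
   by m + 2; [legendreSS] gives back the undivided form. *)
Fixpoint legendre (R : realType) (n : nat) : {poly R} :=
  match n with
  | 0%N => 1
  | n1.+1 =>
    match n1 with
    | 0%N => 'X
    | m.+1 =>
      (m + 2)%:R^-1 *: ((2 * m + 3)%:R *: ('X * legendre R n1)
                        - (m + 1)%:R *: legendre R m)
    end
  end.

Lemma legendre0 (R : realType) : legendre R 0 = 1.
Proof. by []. Qed.

Lemma legendre1 (R : realType) : legendre R 1 = 'X.
Proof. by []. Qed.

Lemma legendreSS (R : realType) (n : nat) :
  (n + 2)%:R *: legendre R n.+2 =
  (2 * n + 3)%:R *: ('X * legendre R n.+1) - (n + 1)%:R *: legendre R n.
Proof.
rewrite [legendre R n.+2]/= scalerA divff ?scale1r //.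
by rewrite pnatr_eq0 addn2.
Qed.

Lemma legendre_horner1 (R : realType) (n : nat) : (legendre R n).[1] = 1.
Proof.
suff: (legendre R n).[1] = 1 /\ (legendre R n.+1).[1] = 1 by case.
elim: n => [|n [IH0 IH1]]; first by rewrite legendre0 legendre1 !hornerE.
split=> //; have n2 : (n + 2)%:R != 0 :> R by rewrite pnatr_eq0 addn2.
apply: (mulfI n2); rewrite -hornerZ legendreSS.
rewrite hornerD hornerN !hornerZ hornerM hornerX IH0 IH1 !mulr1 -natrB.
  by congr _%:R; rewrite mul2n -addnn; apply/eqP; rewrite -(eqn_add2r (n + 1)) subnK;
     [rewrite [(n + 2 + _)%N]addnACA | rewrite -addnA leq_add ?leq_addl // addn_gt0 orbT].
by rewrite mul2n -addnn -addnA leq_add // addn_gt0 orbT.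
Qed.

(* Main.v *)
(* With a = P_{k-1}, b = P_k, c = P_{k+1}, the recurrence turns
   (k+1) (x b^2 - a c) into the quadratic form
   q_k(a, b) = k a^2 - (2k+1) x a b + (k+1) x b^2.  For 0 < x < 1 we prove
   q_k(P_{k-1}, P_k) > 0 by induction on k.  Put t = 1 - x.  Away from t = 0
   the form q_{k+1} is positive definite.  Near t = 0 it is indefinite, but then
   q_{k+1}(b, c) >= s q_k(a, b) as quadratic forms in (a, b), for the multiplier
   s = k (1 - 2 (k+1) t) / (k+1) > 0.  Negative x follow by parity. *)

Require Import Defs.
From mathcomp Require Import all_boot all_order all_algebra.
From mathcomp Require Import reals.
From mathcomp Require Import ring lra.

Import Order.TTheory GRing.Theory Num.Theory.
Local Open Scope ring_scope.

Definition turan_form {R : realFieldType} (k x a b : R) : R :=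
  k * a ^+ 2 - (2 * k + 1) * x * a * b + (k + 1) * x * b ^+ 2.

(** Complete the square in [a]: the hypothesis [disc] is negativity of the discriminant, divided by
    x > 0. *)
Lemma turan_form_gt0 (R : realFieldType) (k x a b : R) :
  0 < k -> 0 < x -> (2 * k + 1) ^+ 2 * x < 4 * k * (k + 1) ->
  (a != 0) || (b != 0) -> 0 < turan_form k x a b.
Proof.
move=> k0 x0 disc ab0.
have E : 4 * k * turan_form k x a b =
    (2 * k * a - (2 * k + 1) * x * b) ^+ 2
    + x * (4 * k * (k + 1) - (2 * k + 1) ^+ 2 * x) * b ^+ 2.
  by rewrite /turan_form; ring.
have k40 : 0 < 4 * k by lra.
rewrite -(pmulr_rgt0 _ k40) E.
have [b0|b0] := eqVneq b 0.
  move: ab0; rewrite b0 eqxx orbF => a0.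
  rewrite mulr0 subr0 expr0n mulr0 addr0 exprn_even_gt0 //=.
  by rewrite !mulf_neq0 // ?gt_eqF.
apply: ltr_wpDl; first exact: sqr_ge0.
by rewrite mulr_gt0 ?exprn_even_gt0 // mulr_gt0 ?subr_gt0.
Qed.

(* Exact form of [q_{k+1} >= s q_k]: the square and the last summand complete
   the square of the difference of the two forms, and [A] is its coefficient of
   [a ^+ 2] (up to [(k + 1) ^+ 2]). *)
Lemma turan_form_step_eq (R : realFieldType) (k t a b c : R) :
  (k + 1) * c = (2 * k + 1) * (1 - t) * b - k * a ->
  let A := k ^+ 2 * (1 + k * (3 + 2 * k) * t) in
  exists B, 4 * A * ((k + 1) ^+ 2 * turan_form (k + 1) (1 - t) b c) =
    4 * A * (k * (k + 1) * (1 - 2 * (k + 1) * t) * turan_form k (1 - t) a b)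
    + (2 * A * a + B * b) ^+ 2
    + 4 * k ^+ 2 * t ^+ 2
      * ((k + 1) ^+ 4 * (2 - ((2 * k + 1) * t) ^+ 2)
         + 2 * k * (3 + 14 * k + 26 * k ^+ 2 + 24 * k ^+ 3 + 11 * k ^+ 4
                    + 2 * k ^+ 5) * t) * b ^+ 2.
Proof.
move=> Ec A.
(* [B] is the coefficient of a b in (k+1)^2 (q_{k+1} - s q_k) once c is eliminated. *)
exists ((2 * k + 3) * (1 - t) * (k + 1) * k
        - 2 * (k + 2) * (2 * k + 1) * k * (1 - t) ^+ 2
        + k * (k + 1) * (1 - 2 * (k + 1) * t) * (2 * k + 1) * (1 - t)).
(* The factor (k+1)^2 lets c occur only through (k+1) c, which [Ec] replaces without division. *)
have -> : (k + 1) ^+ 2 * turan_form (k + 1) (1 - t) b c =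
    (k + 1) ^+ 3 * b ^+ 2
    - (2 * k + 3) * (1 - t) * (k + 1) * b * ((k + 1) * c)
    + (k + 2) * (1 - t) * ((k + 1) * c) ^+ 2.
  by rewrite /turan_form; ring.
by rewrite Ec /A /turan_form; ring.
Qed.

Lemma turan_form_step (R : realFieldType) (k x a b c : R) :
  1 <= k -> 0 < x < 1 -> (k + 1) * c = (2 * k + 1) * x * b - k * a ->
  0 < turan_form k x a b -> 0 < turan_form (k + 1) x b c.
Proof.
move=> k1 /andP[x0 x1] Ec ab_gt0.
have [far|near] := ltP ((2 * (k + 1) + 1) ^+ 2 * x) (4 * (k + 1) * (k + 1 + 1)).
  apply: turan_form_gt0 => //; first lra.
  (* If b = c = 0, the recurrence forces a = 0, and q_k(a, b) would vanish. *)
  apply: contraTT ab_gt0; rewrite negb_or !negbK => /andP[/eqP b0 /eqP c0].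
  move: Ec; rewrite b0 c0 !mulr0 sub0r => /esym/eqP.
  rewrite oppr_eq0 mulf_eq0 => /orP[/eqP k0|/eqP ->]; first lra.
  by rewrite /turan_form !expr0n !mulr0 subr0 addr0 ltxx.
pose t := 1 - x; have Ex : x = 1 - t by rewrite /t; ring.
have t0 : 0 < t by rewrite /t; lra.
(* Since 4(k+1)(k+2) = (2k+3)^2 - 1, [near] says (2k+3)^2 t <= 1, and (2k+3)^2 > 4(k+1). *)
have tk : 4 * (k + 1) * t < 1.
  move: near; rewrite Ex => near; nra.
rewrite Ex in Ec ab_gt0 *.
have [B] := turan_form_step_eq _ _ _ _ _ _ Ec; set A := k ^+ 2 * _ => EB.
have k0 : 0 < k by lra.
have A0 : 0 < A.
  by rewrite /A !mulr_gt0 ?exprn_gt0 // ltr_wpDr // !mulr_ge0 //; lra.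
have A4 : 0 < 4 * A by lra.
have kk : 0 < (k + 1) ^+ 2 by rewrite exprn_gt0 //; lra.
rewrite -(pmulr_rgt0 _ kk) -(pmulr_rgt0 _ A4) EB.
(* The b^2 remainder is nonnegative because (2k+1) t <= 1. *)
apply: ltr_wpDr.
  apply: mulr_ge0 (sqr_ge0 b).
  apply: mulr_ge0.
    exact: mulr_ge0 (mulr_ge0 (ler0n R 4) (sqr_ge0 _)) (sqr_ge0 _).
  apply: addr_ge0.
    rewrite mulr_ge0 ?exprn_ge0 //; first lra.
    have u0 : 0 <= (2 * k + 1) * t by rewrite mulr_ge0 //; lra.
    have u1 : (2 * k + 1) * t <= 1 by nra.
    have : ((2 * k + 1) * t) ^+ 2 <= 1 by rewrite exprn_ile1.
    lra.
  rewrite !mulr_ge0 //; try lra.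
  by rewrite !addr_ge0 // ?mulr_ge0 ?exprn_ge0 //; lra.
apply: ltr_wpDr; first exact: sqr_ge0.
have s0 : 0 < 1 - 2 * (k + 1) * t by lra.
have k1_gt0 : 0 < k + 1 by lra.
exact: mulr_gt0 A4 (mulr_gt0 (mulr_gt0 (mulr_gt0 k0 k1_gt0) s0) ab_gt0).
Qed.

(** Coefficients are written in k = n + 1, the shape that [turan_form_step] expects. *)
Lemma horner_legendreSS (R : realType) (n : nat) (x : R) :
  (n.+1%:R + 1) * (legendre R n.+2).[x] =
  (2 * n.+1%:R + 1) * x * (legendre R n.+1).[x] - n.+1%:R * (legendre R n).[x].
Proof.
have -> : n.+1%:R + 1 = (n + 2)%:R :> R by rewrite natr1 addn2.
have -> : 2 * n.+1%:R + 1 = (2 * n + 3)%:R :> R.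
  by rewrite -natrM natr1 mulnS [(2 * n + 3)%N]addnC.
rewrite -hornerZ legendreSS.
by rewrite hornerD hornerN !hornerZ hornerM hornerX mulrA addn1.
Qed.

Lemma turan_form_legendre (R : realType) (n : nat) (x : R) :
  (n.+1%:R + 1) * (x * (legendre R n.+1).[x] ^+ 2
                   - (legendre R n).[x] * (legendre R n.+2).[x]) =
  turan_form n.+1%:R x (legendre R n).[x] (legendre R n.+1).[x].
Proof.
rewrite mulrBr [X in _ - X = _]mulrCA horner_legendreSS /turan_form; ring.
Qed.

Lemma turan_form_legendre_gt0 (R : realType) (n : nat) (x : R) : 0 < x < 1 ->
  0 < turan_form n.+1%:R x (legendre R n).[x] (legendre R n.+1).[x].
Proof.
move=> x01; elim: n => [|n IHn].
  rewrite legendre0 legendre1 hornerX hornerC /turan_form.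
  (* Base case k = 1: q_1(1, x) = 1 - 3x^2 + 2x^3 has a double root at 1. *)
  have -> : 1%:R * 1 ^+ 2 - (2 * 1%:R + 1) * x * 1 * x + (1%:R + 1) * x * x ^+ 2
      = (1 - x) ^+ 2 * (1 + 2 * x) :> R by ring.
  by case/andP: x01 => x0 x1; rewrite mulr_gt0 ?exprn_gt0 //; lra.
rewrite -[n.+2%:R]natr1; apply: turan_form_step IHn => //.
  by rewrite ler1n.
by rewrite horner_legendreSS.
Qed.

Lemma horner_legendreN (R : realType) (n : nat) (x : R) :
  (legendre R n).[- x] = (-1) ^+ n * (legendre R n).[x].
Proof.
suff: (legendre R n).[- x] = (-1) ^+ n * (legendre R n).[x] /\
      (legendre R n.+1).[- x] = (-1) ^+ n.+1 * (legendre R n.+1).[x] by case.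
elim: n => [|n [IH0 IH1]].
  by rewrite legendre0 legendre1 !hornerC !hornerX expr0 expr1 mul1r mulN1r.
split=> //; have n0 : (n.+1%:R + 1 : R) != 0 by rewrite natr1 pnatr_eq0.
apply: (mulfI n0); rewrite horner_legendreSS IH0 IH1 [RHS]mulrCA horner_legendreSS.
by rewrite !exprS; ring.
Qed.

(** At 0 the middle term of the recurrence drops out, so P_{n+2}(0) is a nonzero multiple of
    P_n(0). *)
Lemma horner_legendre_at0_eq0 (R : realType) (n : nat) :
  ((legendre R n).[0] == 0) = odd n.
Proof.
suff: ((legendre R n).[0] == 0) = odd n /\
      ((legendre R n.+1).[0] == 0) = odd n.+1 by case.
elim: n => [|n [IH0 IH1]].
  by rewrite legendre0 legendre1 hornerC hornerX oner_eq0 eqxx.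
split=> //=; have n0 : (n.+1%:R + 1 : R) != 0 by rewrite natr1 pnatr_eq0.
rewrite negbK -IH0 -(mulrI_eq0 _ (mulfI n0)) horner_legendreSS mulr0 mul0r sub0r.
by rewrite oppr_eq0 mulf_eq0 pnatr_eq0.
Qed.

(** Both terms are even in x: one contains a square, the other a product of two polynomials of equal
    parity. *)
Lemma turan_abs (R : realType) (n : nat) (x : R) :
  `|x| * (legendre R n.+1).[x] ^+ 2 - (legendre R n).[x] * (legendre R n.+2).[x]
  = `|x| * (legendre R n.+1).[`|x|] ^+ 2
    - (legendre R n).[`|x|] * (legendre R n.+2).[`|x|].
Proof.
have [//|x0] := ger0P x; rewrite !horner_legendreN !exprS.
have := sqrr_sign R n; rewrite -signr_odd; set e := (-1) ^+ _ => e2.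
set p := (_).[x]; set q := (_).[x]; set r := (_).[x].
transitivity (- x * (e ^+ 2 * p ^+ 2) - e ^+ 2 * (q * r)); last by ring.
by rewrite e2; ring.
Qed.

Theorem theorem1p1 (R : realType) (n : nat) (x : R)
  (hn : (1 <= n)%N) (hx : -1 <= x <= 1) :
  0 <= `|x| * (legendre R n).[x] ^+ 2
       - (legendre R n.-1).[x] * (legendre R n.+1).[x]
  /\ (`|x| * (legendre R n).[x] ^+ 2
       - (legendre R n.-1).[x] * (legendre R n.+1).[x] = 0
      <-> (x = 0 /\ ~~ odd n) \/ `|x| = 1).
Proof.
case: n hn => [//|n] _; rewrite [n.+1.-1]/= turan_abs.
have n0 : 0 < n.+1%:R + 1 :> R by rewrite natr1 ltr0n.
have [-> |x0] := eqVneq x 0.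
  set D := (X in 0 <= X); rewrite normr0 in @D *.
  (* At 0 only the a^2 term of the form survives. It vanishes exactly for odd [n], that is, for even
     index n + 1 in the theorem. *)
  have ED : (n.+1%:R + 1) * D = n.+1%:R * (legendre R n).[0] ^+ 2.
    by rewrite /D turan_form_legendre /turan_form; ring.
  split; first by rewrite -(pmulr_rge0 _ n0) ED mulr_ge0 ?sqr_ge0.
  have : (D == 0) = odd n.
    rewrite -(mulrI_eq0 D (mulfI (lt0r_neq0 n0))) ED mulf_eq0 pnatr_eq0 /=.
    by rewrite sqrf_eq0 horner_legendre_at0_eq0.
  rewrite /= negbK => <-; split=> [/eqP|]; first by left.
  by case=> [[_ /eqP]//|/eqP]; rewrite eq_sym oner_eq0.
have y0 : 0 < `|x| by rewrite normr_gt0.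
have: `|x| <= 1 by rewrite ler_norml.
rewrite le_eqVlt => /orP[/eqP y1|y1].
  rewrite y1 !legendre_horner1 expr1n mulr1 subrr; split=> //.
  by split=> // _; right.
(* For 0 < |x| < 1 the inequality is strict, which excludes equality. *)
have D0 : 0 < `|x| * (legendre R n.+1).[`|x|] ^+ 2
              - (legendre R n).[`|x|] * (legendre R n.+2).[`|x|].
  rewrite -(pmulr_rgt0 _ n0) turan_form_legendre.
  by apply: turan_form_legendre_gt0; rewrite y0.
split; first exact: ltW.
split=> [E|[[/eqP]|E]]; first by rewrite E ltxx in D0.
  by rewrite (negPf x0).
by rewrite E ltxx in y1.
Qed.
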